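(* Let $w \ge 1$ be an integer and $J_m = (2^m-(-1)^m)/3$. For every integer $N$ with $J_w < N \le J_{w+1}$ we have $a(N) = w$.
   Context: Setting (alternator coin problem): There are $N$ identical-looking coins. All but one are real and have the same weight. The remaining coin, the alternator, behaves as follows: each time it is placed on a balance scale it weighs either the same as a real coin (''acts real'') or strictly less than a real coin (''acts fake''), and it switches between these two behaviours every time it is on the scale; while off the scale its behaviour does not change. A weighing places two disjoint sets of coins with the same number of coins on the two pans, and its outcome is one of: the pans balance, the left pan is lighter, or the right pan is lighter. Weighings may be chosen adaptively based on earlier outcomes. A strategy finds the alternator if, for every possible identity of the alternator and every possible starting behaviour, the outcomes determine which coin it is. $a(N)$ is the smallest number of weighings that guarantees finding the alternator among $N$ coins when it is not known whether its first appearance on the scale will be as a real or as a fake coin. $J_m=(2^m-(-1)^m)/3$ is the $m$-th Jacobsthal number ($J_0=0,J_1=1,J_2=1,J_3=3,J_4=5,\dots$). *)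

(* Defs.v *)
From mathcomp Require Import all_boot all_order all_algebra.
Set Implicit Arguments.
Unset Strict Implicit.
Unset Printing Implicit Defensive.

Definition jacobsthal (m : nat) : rat := ((2 ^+ m - (-1) ^+ m) / 3)%R.

Record weighing (N : nat) := Weighing {
  left_pan : {set 'I_N};
  right_pan : {set 'I_N};
  pans_disjoint : [disjoint left_pan & right_pan];
  pans_same_size : #|left_pan| = #|right_pan|
}.

Inductive outcome := Balance | LeftLighter | RightLighter.

(* [fake] tells how the alternator [alt] acts the next time it is weighed.
   As the pans hold equally many coins, only [alt] acting fake tips them. *)
Definition weigh (N : nat) (p : weighing N) (alt : 'I_N) (fake : bool) :
    outcome :=
  if fake && (alt \in left_pan p) then LeftLighter
  else if fake && (alt \in right_pan p) then RightLighter
  else Balance.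

Definition next_fake (N : nat) (p : weighing N) (alt : 'I_N) (fake : bool) :
    bool :=
  if alt \in left_pan p :|: right_pan p then ~~ fake else fake.

Inductive strategy (N : nat) :=
  | Stop
  | Weigh (p : weighing N) (next : outcome -> strategy N).
Arguments Stop {N}.

Fixpoint outcomes (N : nat) (s : strategy N) (alt : 'I_N) (fake : bool) :
    seq outcome :=
  match s with
  | Stop => [::]
  | Weigh p next =>
      let o := weigh p alt fake in
      o :: outcomes (next o) alt (next_fake p alt fake)
  end.

Definition finds_alternator (N : nat) (s : strategy N) : Prop :=
  forall (alt1 alt2 : 'I_N) (fake1 fake2 : bool),
    outcomes s alt1 fake1 = outcomes s alt2 fake2 -> alt1 = alt2.

Definition uses_at_most (N : nat) (s : strategy N) (w : nat) : Prop :=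
  forall (alt : 'I_N) (fake : bool), size (outcomes s alt fake) <= w.

Definition can_find_within (N w : nat) : Prop :=
  exists s : strategy N, finds_alternator s /\ uses_at_most s w.

(* [is_a N w] says that a(N) = w: the least number of weighings is w. *)
Definition is_a (N w : nat) : Prop :=
  can_find_within N w /\ forall v : nat, can_find_within N v -> w <= v.

(* Main.v *)
Require Import Defs.
From mathcomp Require Import all_boot all_order all_algebra.
From mathcomp Require Import zify ring.
Set Implicit Arguments.
Unset Strict Implicit.
Unset Printing Implicit Defensive.

(** Lower bound: suppose every coin, were it the alternator, would act real at
    its first appearance.  The resulting outcome sequences start with a balance,
    never contain two consecutive imbalances, and must be pairwise distinct;
    there are only [J_(w+1)] such sequences of length [w].

    Upper bound: as long as all weighings balance, a coin is either unknown
    (never weighed), "due fake" (weighed once, hence acting fake next), or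
    genuine.  With [w] weighings left, [u] unknown and [2p] due-fake coins are
    handled whenever [u <= J_(w+1)] and [2u + 2p <= J_(w+2) + 1] ([- 1] if [u] is
    even), by weighing coins of each kind symmetrically.  An imbalance leaves
    the coins of one pan, all of them acting real next, and at least as many
    genuine coins. *)

Fixpoint jac (m : nat) : nat :=
  match m with
  | 0 => 0
  | 1 => 1
  | (m'.+1 as m1).+1 => jac m1 + 2 * jac m'
  end.
Arguments jac : simpl never.

Lemma jacSS m : jac m.+2 = jac m.+1 + 2 * jac m.
Proof. by []. Qed.

Lemma jacobsthal_jac m : jacobsthal m = ((jac m)%:R)%R.
Proof.
suff [] : jacobsthal m = ((jac m)%:R)%R /\ jacobsthal m.+1 = ((jac m.+1)%:R)%R by [].
rewrite /jacobsthal; elim: m => [|m [IH0 IH1]]; first by split.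
split=> //; rewrite jacSS GRing.natrD GRing.natrM -IH0 -IH1 !GRing.exprS.
by field.
Qed.

Lemma jac_odd m : odd (jac m.+1).
Proof. by elim: m => // m IH; rewrite jacSS oddD oddM IH. Qed.

Lemma leq_jac m n : m <= n -> jac m <= jac n.
Proof.
have step k : jac k <= jac k.+1 by case: k => // k; rewrite jacSS leq_addr.
by move=> /subnK <-; elim: (n - m) => // d /leq_trans; apply; exact: step.
Qed.

(** By the closed form, each Jacobsthal number differs from twice the previous one by one, with
    alternating sign; these inequalities keep what holds for either sign. *)
Lemma double_jac m : 2 * jac m.+1 <= (jac m.+2).+1 /\ jac m.+2 <= (2 * jac m.+1).+1.
Proof. by elim: m => // m [IH1 IH2]; rewrite !(jacSS m.+1); lia. Qed.

Lemma exists_disjoint_subsets (T : finType) (A : {set T}) (a b : nat) :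
  a + b <= #|A| ->
  exists B C : {set T}, [/\ B \subset A, C \subset A, [disjoint B & C],
    #|B| = a & #|C| = b].
Proof.
have sub (D : {set T}) k : k <= #|D| -> exists2 E : {set T}, E \subset D & #|E| = k.
  move=> kD; exists [set x in take k (enum D)].
    by apply/subsetP=> x; rewrite inE => /mem_take; rewrite mem_enum.
  rewrite cardsE (card_uniqP _) ?take_uniq ?enum_uniq // size_take -cardE.
  by case: ltngtP kD.
move=> abA; have [|B sBA cB] := sub A a; first exact: leq_trans (leq_addr b a) abA.
have [|C sCA cC] := sub (A :\: B) b.
  by rewrite cardsD (setIidPr sBA) cB; lia.
exists B, C; split=> //; first exact: subset_trans sCA (subsetDl _ _).
rewrite disjoint_sym; apply: (disjointWl sCA).
by rewrite -setI_eq0; apply/eqP/setP=> x; rewrite !inE; case: (x \in B); rewrite ?andbF.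
Qed.

(** A weighing does not preserve the assumption that all suspects act real, so the induction also
    bounds mixed behaviours [st]. A tip leaves only suspects acting real next and a balance leaves a
    mixed set, which matches the recurrence for [jac w.+3]. *)
Lemma card_suspects (N w : nat) (s : strategy N) (st : 'I_N -> bool)
    (A : {set 'I_N}) :
  {in A &, injective (fun i => outcomes s i (st i))} ->
  (forall i, i \in A -> size (outcomes s i (st i)) <= w) ->
  #|A| <= jac w.+2 /\ ((forall i, i \in A -> st i = false) -> #|A| <= jac w.+1).
Proof.
elim: w s st A => [|w IH] [|p next] st A /= inj sz.
- have A1 : #|A| <= 1 by apply/card_le1_eqP=> i j iA jA; apply: inj.
  by split.
- have A0 : #|A| = 0.
    by apply/eqP; rewrite cards_eq0; apply/set0Pn=> -[i /sz].
  by rewrite A0.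
- have A1 : #|A| <= 1 by apply/card_le1_eqP=> i j iA jA; apply: inj.
  by split=> [|_]; apply: leq_trans A1 _; apply: (@leq_jac 1).
have {}IH o (B : {set 'I_N}) : B \subset A ->
    (forall i, i \in B -> weigh p i (st i) = o) ->
    #|B| <= jac w.+2 /\
    ((forall i, i \in B -> next_fake p i (st i) = false) -> #|B| <= jac w.+1).
  move=> /subsetP sBA Bo.
  apply: (IH (next o) (fun i => next_fake p i (st i)) B) => [i j iB jB eq_ij|i iB].
    by apply: inj; rewrite ?sBA // !Bo // eq_ij.
  by have := sz i (sBA i iB); rewrite Bo.
split=> [|st0]; last first.
  (* When all suspects act real the weighing must balance, so the mixed bound with one weighing
     fewer applies to all of [A]. *)
  by have [] := IH Balance A (subxx A) => // i /st0; rewrite /weigh => ->.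
pose L := [set i in A | st i && (i \in left_pan p)].
pose R := [set i in A | st i && (i \in right_pan p)].
have cardL : #|L| <= jac w.+1.
  have [||_ ->//] := IH LeftLighter L; first by apply/subsetP=> i; rewrite inE => /andP[].
    by move=> i; rewrite inE /weigh => /and3P[_ -> ->].
  by move=> i; rewrite /next_fake !inE => /and3P[_ -> ->].
have cardR : #|R| <= jac w.+1.
  have [||_ ->//] := IH RightLighter R; first by apply/subsetP=> i; rewrite inE => /andP[].
    move=> i; rewrite inE /weigh => /and3P[_ -> iR].
    by rewrite (disjointFl (pans_disjoint p) iR) iR.
  by move=> i; rewrite /next_fake !inE => /and3P[_ -> ->]; rewrite orbT.
have [||cardB _] := IH Balance (A :\: (L :|: R)); first exact: subsetDl.
  move=> i; rewrite !inE /weigh; case: (i \in A); last by rewrite andbF.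
  by rewrite /= andbT negb_or => /andP[/negbTE -> /negbTE ->].
have cardI : #|A :&: (L :|: R)| <= #|L| + #|R|.
  exact: leq_trans (subset_leq_card (subsetIr _ _)) (leq_card_setU L R).
by rewrite -(cardsID (L :|: R) A) (jacSS w.+1); lia.
Qed.

(** [Q] holds the pairs of coin and next behaviour that are still possible. [N] stays fixed, so
    excluded coins remain available as genuine ones. *)
Definition solvable (N w : nat) (Q : 'I_N -> bool -> Prop) : Prop :=
  exists2 s : strategy N, uses_at_most s w &
  forall (i j : 'I_N) (f g : bool), Q i f -> Q j g ->
    outcomes s i f = outcomes s j g -> i = j.

Lemma solvable_stop (N w : nat) (Q : 'I_N -> bool -> Prop) (A : {set 'I_N}) :
  #|A| <= 1 -> (forall i f, Q i f -> i \in A) -> solvable w Q.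
Proof.
move=> /card_le1_eqP A1 QA; exists Stop => // i j f g Qi Qj _.
exact: A1 (QA _ _ Qj) (QA _ _ Qi).
Qed.

Lemma solvable_weigh (N w : nat) (Q : 'I_N -> bool -> Prop) (p : weighing N)
    (Q' : outcome -> 'I_N -> bool -> Prop) :
  (forall o, solvable w (Q' o)) ->
  (forall i f, Q i f -> Q' (weigh p i f) i (next_fake p i f)) ->
  solvable w.+1 Q.
Proof.
move=> slv QQ'; have [sb szb injb] := slv Balance.
have [sl szl injl] := slv LeftLighter; have [sr szr injr] := slv RightLighter.
exists (Weigh p (fun o => match o with
  Balance => sb | LeftLighter => sl | RightLighter => sr end)).
  by move=> i f /=; case: (weigh p i f); [apply: szb|apply: szl|apply: szr].
move=> i j f g /QQ' Qi /QQ' Qj /= [eq_o].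
by rewrite -eq_o in Qj *; case: (weigh p i f) Qi Qj => [/injb|/injl|/injr]; apply.
Qed.

(* The alternator is in [S] and acts fake at its next appearance iff [b]. *)
Definition known (N : nat) (S : {set 'I_N}) (b : bool) (i : 'I_N) (f : bool) : Prop :=
  i \in S /\ f = b.

Lemma solvable_known (N w : nat) (S : {set 'I_N}) :
  2 * #|S| <= N ->
  (#|S| <= jac w.+2 -> solvable w (known S true)) /\
  (#|S| <= jac w.+1 -> solvable w (known S false)).
Proof.
elim: w S => [|w IH] S SN.
  by split=> S1; apply: (solvable_stop _ S1) => i f [].
split=> cardS.
  (* Each pan takes as many suspects as can be resolved after a tip. The remainder is then at most
     [jac w.+2], or a single coin. *)
  pose x := minn (jac w.+1) (#|S| %/ 2).
  have [|B [C [sBS sCS dBC cB cC]]] := @exists_disjoint_subsets _ S x x.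
    by rewrite /x; lia.
  have dBC' := dBC; rewrite -setI_eq0 in dBC'.
  have cBC : #|B :|: C| = 2 * x by rewrite cardsU (eqP dBC') cards0; lia.
  have cardD : #|S :\: (B :|: C)| = #|S| - 2 * x.
    by rewrite cardsD (setIidPr _) ?subUset ?sBS // cBC.
  pose p := @Weighing N B C dBC (etrans cB (esym cC)).
  apply: (@solvable_weigh _ _ _ p (fun o => match o with
    Balance => known (S :\: (B :|: C)) true
    | LeftLighter => known B false
    | RightLighter => known C false end)).
    have jac_gt0 : 0 < jac w.+2 by apply: (@leq_jac 1).
    rewrite (jacSS w.+1) in cardS.
    by case; [apply: (IH _ _).1|apply: (IH _ _).2|apply: (IH _ _).2];
      rewrite ?cardD ?cB ?cC /x; lia.
  move=> i _ [iS ->]; rewrite /weigh /next_fake /= inE.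
  case: (boolP (i \in B)) => iB /=; first by split.
  case: (boolP (i \in C)) => iC /=; first by split.
  by split; rewrite // !inE negb_or iB iC.
(* Suspects acting real are weighed against genuine coins: the pans surely balance, and every
   suspect acts fake next. *)
have [|C [_ [sCS _ _ cC _]]] := @exists_disjoint_subsets _ (~: S) #|S| 0.
  by have := cardsC S; rewrite card_ord; lia.
have dSC : [disjoint S & C] by rewrite disjoint_sym disjoints_subset.
apply: (@solvable_weigh _ _ _ (Weighing dSC (esym cC)) (fun=> known S true)).
  by move=> _; have [+ _] := IH S SN; apply.
by move=> i _ [iS ->]; rewrite /known /next_fake inE iS.
Qed.

(** Each pan will receive [x] due-fake and [y] unknown coins, out of [2 * q] and [u]. *)
Lemma symmetric_choice (w u q : nat) :
  u <= jac w.+2 -> 2 * (u + q) + ~~ odd u <= jac w.+3 + odd u ->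
  exists x y, [/\ x <= q, 2 * y <= u, x + y <= jac w.+1, u - 2 * y <= jac w.+1 &
    2 * (u - 2 * y + (q - x + y)) + ~~ odd u <= jac w.+2 + odd u].
Proof.
move=> hu hq.
have o1 := jac_odd w; have o2 := jac_odd w.+1; have o3 := jac_odd w.+2.
have [d1 d2] := double_jac w.
rewrite (jacSS w.+1) in hq o3; move: (jac w.+1) (jac w.+2) o1 o2 o3 d1 d2 hu hq => a b.
move=> o1 o2 o3 d1 d2 hu hq.
have [all_in|not_all] := leqP (q + u %/ 2) a.
  by exists q, (u %/ 2); split; lia.
(* The pans are filled to exactly [a] coins each, with the least [y] giving [u - 2 * y <= a] and
   [a - y <= q]. This lowers [u + q] by [a], as the recurrence requires. *)
pose y := maxn ((u - a).+1 %/ 2) (a - q).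
by exists (a - y), y; rewrite /y; split; lia.
Qed.

Definition unknown_or_due_fake (N : nat) (U F : {set 'I_N}) (i : 'I_N) (f : bool) : Prop :=
  i \in U \/ i \in F /\ f.

(** An unknown coin accounts for two outcome sequences, a due-fake coin for one. If [#|U|] is odd,
    one coin is never weighed while the pans balance and costs only one sequence, hence the parity
    terms. *)
Lemma solvable_unknown_or_due_fake (N w q : nat) (U F : {set 'I_N}) :
  [disjoint U & F] -> #|F| = 2 * q -> #|U| <= jac w.+1 ->
  2 * (#|U| + q) + ~~ odd #|U| <= jac w.+2 + odd #|U| ->
  solvable w (unknown_or_due_fake U F).
Proof.
elim: w q U F => [|w IH] q U F dUF cF cU cUF.
  apply: (@solvable_stop _ _ _ (U :|: F)) => [|i f [iU|[iF _]]]; last 2 first.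
  - by rewrite inE iU.
  - by rewrite inE iF orbT.
  by rewrite cardsU; move: cU cUF; rewrite -[jac 1]/1 -[jac 2]/1; lia.
have [x [y [xq yu xyw uy cond]]] := symmetric_choice cU cUF.
have [|X1 [X2 [sX1 sX2 dX cX1 cX2]]] := @exists_disjoint_subsets _ F x x; first by lia.
have [|Y1 [Y2 [sY1 sY2 dY cY1 cY2]]] := @exists_disjoint_subsets _ U y y; first by lia.
have dXY (X Y : {set 'I_N}) : X \subset F -> Y \subset U -> [disjoint X & Y].
  by move=> sX sY; rewrite disjoint_sym; apply: disjointWl sY _; apply: disjointWr sX _.
have cardU (B C : {set 'I_N}) : [disjoint B & C] -> #|B :|: C| = #|B| + #|C|.
  by rewrite -leq_card_setU => /eqP.
have dP : [disjoint X1 :|: Y1 & X2 :|: Y2].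
  rewrite disjoints_subset setCU subUset !subsetI -!disjoints_subset dX dY (dXY X1 Y2) //.
  by rewrite disjoint_sym (dXY X2 Y1).
have c1 : #|X1 :|: Y1| = x + y by rewrite cardU ?cX1 ?cY1 // dXY.
have c2 : #|X2 :|: Y2| = x + y by rewrite cardU ?cX2 ?cY2 // dXY.
(* After a tip, the coins of the other pan are genuine and as numerous as the suspects. *)
have cN : 2 * (x + y) <= N.
  by have := max_card (mem ((X1 :|: Y1) :|: (X2 :|: Y2))); rewrite cardU // c1 c2 card_ord; lia.
(* After a balance, weighed due-fake coins are cleared and weighed unknown coins become due fake. *)
pose U' := U :\: (Y1 :|: Y2); pose F' := (F :\: (X1 :|: X2)) :|: (Y1 :|: Y2).
have cU' : #|U'| = #|U| - 2 * y.
  by rewrite cardsD (setIidPr _) ?subUset ?sY1 // cardU // cY1 cY2; lia.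
have cF' : #|F'| = 2 * (q - x + y).
  rewrite cardU; last by apply: dXY; [exact: subsetDl | rewrite subUset sY1].
  by rewrite cardsD (setIidPr _) ?subUset ?sX1 // !cardU // cX1 cX2 cY1 cY2; lia.
apply: (@solvable_weigh _ _ _ (Weighing dP (etrans c1 (esym c2))) (fun o => match o with
    Balance => unknown_or_due_fake U' F'
    | LeftLighter => known (X1 :|: Y1) false
    | RightLighter => known (X2 :|: Y2) false end)).
  case; last 2 first.
  - by apply: (solvable_known _ _).2; rewrite c1.
  - by apply: (solvable_known _ _).2; rewrite c2.
  apply: (IH (q - x + y)); rewrite ?cU' ?cF' //.
    rewrite -setI_eq0; apply/eqP/setP=> i; rewrite !inE.
    have := disjointFr dUF (x := i); case: (i \in U) => [->//|_]; last by rewrite andbF.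
    by case: (i \in Y1); case: (i \in Y2); rewrite ?andbF.
  by have -> : odd (#|U| - 2 * y) = odd #|U| by lia.
move=> i f hQ; rewrite /weigh /next_fake /= !inE.
have notin (A B : {set 'I_N}) : A \subset B -> i \notin B -> (i \in A) = false.
  by move=> /subsetP sAB; apply: contraNF; apply: sAB.
case: hQ => [iU|[iF ->]].
  have iF : i \notin F by rewrite (disjointFr dUF iU).
  rewrite (notin _ _ sX1 iF) (notin _ _ sX2 iF) /=.
  case: (boolP (i \in Y1)) => i1 /=.
    by case: f => /=; [split; rewrite ?inE ?i1 ?orbT|right; rewrite !inE i1 orbT].
  case: (boolP (i \in Y2)) => i2 /=.
    by case: f => /=; [split; rewrite ?inE ?i2 ?orbT|right; rewrite !inE i2 !orbT].
  by rewrite !andbF /=; left; rewrite !inE negb_or i1 i2.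
have iU : i \notin U by rewrite (disjointFl dUF iF).
rewrite (notin _ _ sY1 iU) (notin _ _ sY2 iU) !orbF.
case: (boolP (i \in X1)) => i1 /=; first by split; rewrite ?inE ?i1.
case: (boolP (i \in X2)) => i2 /=; first by split; rewrite ?inE ?i2.
by right; rewrite !inE negb_or i1 i2 iF.
Qed.

Theorem mainTheorem6 (w N : nat) (hw : (1 <= w)%N)
  (hlo : (jacobsthal w < N%:R)%R) (hhi : (N%:R <= jacobsthal w.+1)%R) :
  is_a N w.
Proof.
rewrite jacobsthal_jac Num.Theory.ltr_nat in hlo.
rewrite jacobsthal_jac Num.Theory.ler_nat in hhi.
split=> [|v [s [finds uses]]].
  have [||||s uses finds] := @solvable_unknown_or_due_fake N w 0 setT set0.
  - by rewrite disjoint_sym disjoints_subset sub0set.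
  - by rewrite cards0.
  - by rewrite cardsT card_ord.
  (* An even [N] is strictly below the odd [jac w.+1], which pays for the parity term. *)
  - rewrite cardsT card_ord; have [d1 d2] := double_jac w.
    by have := jac_odd w; have := jac_odd w.+1; lia.
  by exists s; split=> // i j f g; apply: finds; left; rewrite inE.
rewrite leqNgt; apply/negP=> vw.
have [||_ ] := @card_suspects N v s (fun=> false) setT.
- by move=> i j _ _ /finds.
- by move=> i _; apply: uses.
move=> /(_ (fun _ _ => erefl)); rewrite cardsT card_ord => /leq_trans.
by move=> /(_ _ (leq_jac vw)); rewrite leqNgt hlo.
Qed.
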